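(* For all $t>0$, $\{\beta_t=0\}=\{\tau\le t\}$ $\mathbf P$-a.s. (that is, the symmetric difference of these two events has $\mathbf P$-probability zero). In particular, $\tau$ is a stopping time with respect to the filtration $\mathbb F^P=(\mathcal F^P_t)_{t\ge 0}$.
   Context: Setting. $(\Omega,\mathcal F,\mathbf P)$ is a complete probability space and $\mathcal N_P$ is the collection of its $\mathbf P$-null sets. $W=(W_t)_{t\ge0}$ is a standard Brownian motion with continuous paths starting from $0$. $\tau:\Omega\to(0,\infty)$ is a strictly positive random variable with distribution function $F(t)=\mathbf P(\tau\le t)$, $t\ge 0$. It is assumed throughout that $\tau$ and $W$ are independent and that $\tau$ is not a stopping time of the completed natural filtration of $W$ (so $\tau$ is not a.s. equal to a constant). The information process $\beta=(\beta_t)_{t\ge0}$ is $$\beta_t:=W_t-\frac{t}{\tau\vee t}W_{\tau\vee t},\quad t\ge0 .$$ The completed natural filtration of $\beta$ is $\mathcal F^P_t:=\sigma(\beta_s,\,0\le s\le t)\vee\mathcal N_P$, $t\ge 0$. *)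

(* Defs.v *)
From HB Require Import structures.
From mathcomp Require Import all_boot all_order all_algebra.
From mathcomp Require Import all_classical all_reals all_analysis.

Set Implicit Arguments.
Unset Strict Implicit.
Unset Printing Implicit Defensive.

Import Order.TTheory GRing.Theory Num.Theory.
Import numFieldNormedType.Exports.

Local Open Scope classical_set_scope.
Local Open Scope ring_scope.

(* Stochastic processes indexed by [0, +oo[ are represented by total functions
   X : R -> T -> R; no definition below depends on X t for t < 0. *)

Definition independent_systems d (T : measurableType d) (R : realType)
    (P : probability T R) (G H : set (set T)) :=
  forall A B, G A -> H B -> P (A `&` B) = (P A * P B)%E.

(* sigma(X_s, s in I) *)
Definition sigma_process (R : realType) (T : Type) (X : R -> T -> R)
    (I : set R) : set (set T) :=
  <<s \bigcup_(s in I) preimage_set_system setT (X s) measurable >>.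

Definition natural_filtration (R : realType) (T : Type) (X : R -> T -> R)
    (t : R) : set (set T) :=
  sigma_process X `[0, t].

(* On a complete probability space, the negligible sets are exactly the
   measurable sets of probability 0. *)
Definition completed_filtration d (T : measurableType d) (R : realType)
    (P : probability T R) (X : R -> T -> R) (t : R) : set (set T) :=
  <<s natural_filtration X t `|` P.-negligible >>.

Definition stopping_time (R : realType) (T : Type) (F : R -> set (set T))
    (tau : T -> R) :=
  forall t, 0 <= t -> F t [set w | tau w <= t].

(* The second parameter of normal_prob is the standard deviation. The law of
   an increment is only compared with the Gaussian law on Borel sets, since
   values of measures on nonmeasurable sets are meaningless. *)
Record brownian_motion d (T : measurableType d) (R : realType)
    (P : probability T R) (W : R -> T -> R) : Prop := BrownianMotion {
  bm_measurable : forall t, 0 <= t -> measurable_fun setT (W t) ;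
  bm_start : forall w, W 0 w = 0 ;
  bm_continuous : forall w, {within `[0, +oo[, continuous (W ^~ w)} ;
  bm_normal : forall s t, 0 <= s -> s < t -> forall A, measurable A ->
    pushforward P (W t \- W s) A = normal_prob 0 (Num.sqrt (t - s)) A ;
  bm_independent : forall s t, 0 <= s -> s < t ->
    independent_systems P (natural_filtration W s)
      (preimage_set_system setT (W t \- W s) measurable)
}.

Definition information_process (R : realType) (T : Type) (W : R -> T -> R)
    (tau : T -> R) (t : R) (w : T) : R :=
  W t w - t / Num.max (tau w) t * W (Num.max (tau w) t) w.

(* Main.v *)
Require Import Defs.
From HB Require Import structures.
From mathcomp Require Import all_boot all_order all_algebra.
From mathcomp Require Import all_classical all_reals all_analysis.
From mathcomp Require Import measurable_realfun.
From mathcomp Require Import ring.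

(** On the event [tau <= t] one has [beta t = W t - W t = 0], so the
    two events differ only by
      [N t = {t < tau and W t - (t / tau) * W tau = 0}],
    and everything reduces to showing that [N t] is a null event.

    Since [tau] is independent of [W], the law of the pair ([tau], path of [W])
    is a product measure, and by Fubini it is enough that for each fixed
    [s > t] the Brownian bridge of length [s] almost surely avoids [0] at time
    [t]. The same argument applies once more: [s * W t - t * W s] equals
    [(s - t) * W t - t * (W s - W t)], where [W t] and [W s - W t] are
    independent, so by Fubini it is enough that the increment [W s - W t] has
    no atom, which holds because its law is a nondegenerate Gaussian. The lemma
    [independent_preimage_null] is the form of Fubini used both times.

    For the first use, the path of [W] is the identity map from the sample
    space to itself, the target being equipped with the sigma-algebra generated
    by [W]. Fubini requires that [(s, w) |-> W s w] be jointly measurable for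
    the product of the Borel sigma-algebra and that one; this is where the
    continuity of the paths enters ([measurable_continuous_process]).

    The bridge equation is used throughout after multiplication by [s > 0],
    which turns its measurability into that of a polynomial expression.

    Finally [tau <= t] is the event [beta t = 0], which belongs to the natural
    filtration of [beta] at time [t], minus the null event [N t]: hence [tau] is
    a stopping time of the completed filtration. *)

Import Order.TTheory GRing.Theory Num.Theory.
Import numFieldNormedType.Exports.

Local Open Scope classical_set_scope.
Local Open Scope ring_scope.

(** * Fubini for independent maps *)

(** By independence the law of [(f, g)] is the product of the laws of [f] and
    [g], and a set whose vertical sections are null for the law of [g] is null
    for that product. *)
Lemma independent_preimage_null d d1 d2 (T : measurableType d)
    (T1 : measurableType d1) (T2 : measurableType d2) (R : realType)
    (P : probability T R) (f : T -> T1) (g : T -> T2) (N : set (T1 * T2)) :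
  measurable_fun setT f -> measurable_fun setT g ->
  independent_systems P (preimage_set_system setT f measurable)
    (preimage_set_system setT g measurable) ->
  measurable N -> (forall x, P (g @^-1` xsection N x) = 0%E) ->
  P ((fun w => (f w, g w)) @^-1` N) = 0%E.
Proof.
move=> mf mg indep mN N0.
have mfg : measurable_fun setT (fun w => (f w, g w)).
  exact: measurable_fun_pair.
pose f' : {mfun T >-> T1} := HB.pack f (isMeasurableFun.Build _ _ _ _ f mf).
pose g' : {mfun T >-> T2} := HB.pack g (isMeasurableFun.Build _ _ _ _ g mg).
pose fg' : {mfun T >-> (T1 * T2)%type} :=
  HB.pack (fun w => (f w, g w)) (isMeasurableFun.Build _ _ _ _ _ mfg).
(* A probability on a product is determined by its values on rectangles. *)
have rect (A : set T1) (B : set T2) : measurable A -> measurable B ->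
    distribution P fg' (A `*` B) = (distribution P f' A * distribution P g' B)%E.
  move=> mA mB; rewrite /distribution /pushforward /= -indep.
  - by [].
  - by exists A => //; rewrite setTI.
  - by exists B => //; rewrite setTI.
rewrite -[LHS]/(distribution P fg' N) -(product_measure_unique rect mN).
rewrite /product_measure1; apply: integral0_eq => x _ /=; exact: N0.
Qed.

(** * Joint measurability of continuous processes *)

Lemma cvg_truncn_ratio {R : realType} {s : R} : 0 <= s ->
  (Num.truncn (n.+1%:R * s))%:R / n.+1%:R @[n --> \oo] --> s.
Proof.
move=> s0; apply: (@squeeze_cvgr _ _ _ _ (fun n => s - n.+1%:R^-1) (cst s)).
- near=> n; have n0 : 0 < n.+1%:R :> R by rewrite ltr0n.
  have /andP[le_t lt_t] := truncn_itv (mulr_ge0 (ltW n0) s0).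
  rewrite /= ler_pdivrMr// ler_pdivlMr// mulrBl mulVf ?gt_eqF// lerBlDr natr1.
  by rewrite mulrC ltW.
- rewrite -[X in _ --> X]subr0; apply: cvgB; first exact: cvg_cst.
  exact: cvg_harmonic.
- exact: cvg_cst.
Unshelve. all: by end_near. Qed.

(** The process is the pointwise limit of the processes obtained by freezing
    time at the last point [k / (n + 1)] of a regular grid: on each strip
    [k / (n + 1) <= s < (k + 1) / (n + 1)] the latter depend on the sample point
    only, hence are measurable, and there are countably many strips. *)
Lemma measurable_continuous_process d (T : measurableType d) (R : realType)
    (X : R -> T -> R) :
  (forall t, 0 <= t -> measurable_fun setT (X t)) ->
  (forall w, {within `[0, +oo[, continuous (X ^~ w)}) ->
  measurable_fun ((`[0, +oo[%classic : set R) `*` setT)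
    (fun z : R * T => X z.1 z.2).
Proof.
move=> mX cX.
pose u (n : nat) (s : R) : R := (Num.truncn (n.+1%:R * s))%:R / n.+1%:R.
have u_ge0 n s : 0 <= u n s by rewrite divr_ge0.
apply: (@measurable_fun_cvg _ _ _ _ (fun n z => X (u n z.1) z.2)).
  move=> n.
  have n0 : 0 < n.+1%:R :> R by rewrite ltr0n.
  pose E (k : nat) : set (R * T) :=
    (`[k%:R / n.+1%:R, k.+1%:R / n.+1%:R[%classic : set R) `*` setT.
  have -> : (`[0, +oo[%classic : set R) `*` setT = \bigcup_k E k.
    apply/seteqP; split=> -[s w] /=.
      rewrite in_itv/= andbT => -[s0 _].
      exists (Num.truncn (n.+1%:R * s)) => //; split => //=.
      have /andP[le_t lt_t] := truncn_itv (mulr_ge0 (ltW n0) s0).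
      by rewrite in_itv/= ler_pdivrMr// ltr_pdivlMr// (mulrC s) le_t.
    move=> [k _ [/= + _]]; rewrite !in_itv/= andbT => /andP[ks _]; split => //.
    by apply: le_trans ks; rewrite divr_ge0.
  apply/measurable_fun_bigcup => [k|k]; first exact: measurableX.
  apply: (eq_measurable_fun (fun z => X (k%:R / n.+1%:R) z.2)).
    move=> -[s w]; rewrite inE => -[/= + _]; rewrite in_itv/=.
    rewrite ler_pdivrMr// ltr_pdivlMr// (mulrC s) => /andP[ks sk].
    by rewrite /u (truncn_def (n := k)) // ks.
  apply: measurable_funTS; apply: measurableT_comp => //.
  by apply: mX; rewrite divr_ge0.
move=> [s w] /= [+ _]; rewrite in_itv/= andbT => s0.
have /subspace_continuousP/(_ s) := cX w.
rewrite /= in_itv/= andbT => /(_ s0) cs.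
apply: cvg_comp cs => A; rewrite /within /= => As.
have := cvg_truncn_ratio s0 _ As.
rewrite /nbhs /=; apply: filterS => n; apply.
by rewrite /= in_itv/= andbT u_ge0.
Qed.

(** * Brownian bridges of deterministic length *)

Section brownian.
Context {d} {T : measurableType d} {R : realType} {P : probability T R}
  {W : R -> T -> R}.
Hypothesis W_brownian : brownian_motion P W.

(** The law is absolutely continuous with respect to Lebesgue measure. *)
Lemma brownian_increment_atomless {s t} x : 0 <= s -> s < t ->
  P ((W t \- W s) @^-1` [set x]) = 0%E.
Proof.
move=> s0 st.
have := bm_normal W_brownian s0 st (measurable_set1 x).
rewrite /pushforward => ->.
apply: (@normal_prob_dominates R 0 _ [set x]) => //.
by apply/measure0_null_setP => //; exact: lebesgue_measure_set1.
Qed.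

(** The bridge is a nondegenerate combination of the independent variables
    [W t] and [W s - W t]: once [W t] is known, it vanishes for exactly one
    value of the increment, and that value has probability zero. *)
Lemma brownian_bridge_zero_null {s t} : 0 < t -> t < s ->
  P [set w | s * W t w - t * W s w = 0] = 0%E.
Proof.
move=> t0 ts; have s0 : 0 < s by exact: lt_trans ts.
have mWt := bm_measurable W_brownian (ltW t0).
have mWs := bm_measurable W_brownian (ltW s0).
pose h (z : R * R) := (s - t) * z.1 - t * z.2.
have mh : measurable_fun setT h.
  by apply: measurable_funB; exact: measurable_funM.
have -> : [set w | s * W t w - t * W s w = 0] =
    (fun w => (W t w, (W s \- W t) w)) @^-1` (h @^-1` [set 0]).
  apply/seteqP; rewrite /h; split => w /= h0; rewrite -[RHS]h0; ring.
apply: independent_preimage_null => //.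
- exact: measurable_funB.
- move=> A B GA HB; apply: (bm_independent W_brownian (ltW t0) ts) => //.
  apply: sub_sigma_algebra; exists t => //=.
  by rewrite in_itv/= lexx ltW.
- by rewrite -[X in measurable X]setTI; exact: mh.
- move=> x.
  rewrite -(brownian_increment_atomless ((s - t) * x / t) (ltW t0) ts).
  congr (P _); apply/seteqP; split=> w /=; rewrite /xsection /= inE /h /=.
    by move/subr0_eq => ->; rewrite mulrC mulKf ?gt_eqF.
  by move=> ->; field; rewrite gt_eqF.
Qed.

End brownian.

(** * Bridges of random length *)

Section path_sigma_algebra.
Context {d} {T : measurableType d} {R : realType} {P : probability T R}
  {W : R -> T -> R}.
Hypothesis W_brownian : brownian_motion P W.

Let G := \bigcup_(s in `[(0:R), +oo[) preimage_set_system setT (W s) measurable.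
(** [TG] is the sample space seen as path space: the same points, with only the
    events determined by the path of [W]. *)
Let TG := g_sigma_algebraType G.

Lemma measurable_path_event (A : set T) :
  sigma_process W `[0, +oo[ A -> measurable A.
Proof.
apply: smallest_sub; first exact: sigma_algebra_measurable.
move=> B [s /=]; rewrite in_itv/= andbT => s0 [C mC <-].
exact: (bm_measurable W_brownian s0).
Qed.

Lemma measurable_path_coordinate {s : R} : 0 <= s ->
  measurable_fun setT (W s : TG -> R).
Proof.
move=> s0 _ B mB; apply: sub_sigma_algebra; exists s.
  by rewrite /= in_itv/= andbT.
by exists B.
Qed.

Let bridge_zeros t : set (R * TG) :=
  [set z | t < z.1 /\ z.1 * W t z.2 - t * W z.1 z.2 = 0].

Lemma measurable_bridge_zeros t : 0 < t -> measurable (bridge_zeros t).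
Proof.
move=> t0.
pose D : set (R * TG) := (`]t, +oo[%classic : set R) `*` setT.
have mD : measurable D by apply: measurableX.
have mW : measurable_fun D (fun z => W z.1 z.2).
  apply: (@measurable_funS _ _ _ _ ((`[0, +oo[%classic : set R) `*` setT)).
  - exact: measurableX.
  - move=> [s w] [/=]; rewrite !in_itv/= !andbT => ts _; split => //.
    by rewrite ltW// (lt_trans t0).
  - apply: (@measurable_continuous_process _ TG R W).
      by move=> s s0; exact: measurable_path_coordinate.
    exact: (bm_continuous W_brownian).
have mh : measurable_fun D (fun z => z.1 * W t z.2 - t * W z.1 z.2).
  apply: measurable_funB; apply: measurable_funM => //.
    exact: measurable_funTS.
  apply: measurable_funTS; apply: measurableT_comp => //.
  exact: measurable_path_coordinate (ltW t0).
have -> : bridge_zeros t = D `&`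
    (fun z => z.1 * W t z.2 - t * W z.1 z.2) @^-1` [set 0].
  apply/seteqP; split => -[s w] /=; rewrite /bridge_zeros /D /= in_itv/= andbT.
    by move=> [].
  by move=> [[]].
exact: mh.
Qed.

Context {tau : {RV P >-> R}}.
Hypothesis tau_W_independent :
  independent_systems P (preimage_set_system setT tau measurable)
    (sigma_process W `[0, +oo[).

(** Conditionally on [tau = s] with [s > t], independence leaves the law of [W]
    unchanged, so the event has the probability that a bridge of deterministic
    length [s] vanishes at [t]. *)
Lemma bridge_zeros_before_end_null {t} : 0 < t ->
  let N := [set w | t < tau w /\ tau w * W t w - t * W (tau w) w = 0] in
  measurable N /\ P N = 0%E.
Proof.
move=> t0 N.
have mid : measurable_fun setT (idfun : T -> TG).
  by move=> _ A mA; rewrite setTI; exact: measurable_path_event.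
have mtau : measurable_fun setT tau by [].
have -> : N = (fun w => (tau w, idfun w : TG)) @^-1` bridge_zeros t by [].
split.
  have m2 : measurable_fun setT (fun w => (tau w, idfun w : TG)).
    exact: measurable_fun_pair.
  rewrite -[X in measurable X]setTI; apply: m2 => //.
  exact: measurable_bridge_zeros.
apply: independent_preimage_null => //.
- move=> A B GA [C mC <-]; apply: tau_W_independent => //.
  by rewrite setTI.
- exact: measurable_bridge_zeros.
move=> s; have [ts|st] := ltP t s.
  rewrite -(brownian_bridge_zero_null W_brownian t0 ts).
  congr (P _); apply/seteqP.
  split=> w /=; rewrite /xsection /= inE /bridge_zeros /=.
    by case.
  by [].
rewrite (_ : _ @^-1` _ = set0) ?measure0//.
apply/seteqP; split=> w //=; rewrite /xsection /= inE /bridge_zeros /= => -[].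
by rewrite ltNge st.
Qed.

End path_sigma_algebra.

(** * Detecting the end of the bridge *)

Theorem proposition3p1 (R : realType) (d : measure_display)
    (Omega : measurableType d) (P : probability Omega R)
    (P_complete : measure_is_complete P)
    (W : R -> Omega -> R) (W_brownian : brownian_motion P W)
    (tau : {RV P >-> R}) (tau_gt0 : forall w, 0 < tau w)
    (tau_W_independent :
      independent_systems P (preimage_set_system setT tau measurable)
        (sigma_process W `[0, +oo[))
    (tau_not_stopping : ~ stopping_time (completed_filtration P W) tau) :
  let beta := information_process W tau in
  (forall t, 0 < t ->
     measurable [set w | beta t w = 0] /\
     P ([set w | beta t w = 0] `+` [set w | tau w <= t]) = 0%E) /\
  stopping_time (completed_filtration P beta) tau.
Proof.
move=> beta.
pose N t := [set w | t < tau w /\ tau w * W t w - t * W (tau w) w = 0].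
have beta0E t : 0 < t -> [set w | beta t w = 0] = [set w | tau w <= t] `|` N t.
  move=> t0; apply/seteqP; rewrite /beta /information_process /N.
  split => w /=; case: leP => [wt|tw].
  - by left.
  - move=> b0; right; split => //; have w0 := tau_gt0 w.
    have -> : tau w * W t w - t * W (tau w) w =
      tau w * (W t w - t / tau w * W (tau w) w) by field; rewrite gt_eqF.
    by rewrite b0 mulr0.
  - by rewrite divff ?gt_eqF// mul1r subrr.
  - case=> // -[_ b0]; have w0 := tau_gt0 w.
    have -> : W t w - t / tau w * W (tau w) w =
      (tau w * W t w - t * W (tau w) w) / tau w by field; rewrite gt_eqF.
    by rewrite b0 mul0r.
have tauE t : 0 < t -> [set w | tau w <= t] = [set w | beta t w = 0] `\` N t.
  move=> t0; rewrite beta0E//; apply/seteqP; split => w /=.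
    by move=> wt; split; [left|case; rewrite ltNge wt].
  by case=> -[].
split.
  move=> t t0.
  have [mN PN] := bridge_zeros_before_end_null W_brownian tau_W_independent t0.
  have mtau : measurable [set w | tau w <= t].
    by rewrite -[X in measurable X]setTI; exact: measurable_fun_le.
  split; first by rewrite beta0E//; exact: measurableU.
  rewrite (_ : _ `+` _ = N t)//; apply/seteqP.
  rewrite beta0E//; split=> w; rewrite /setY /N /=; first by tauto.
  by move=> Nw; left; split; [right|case: Nw => tw _; rewrite leNgt tw].
(* At time [0] the event [tau <= 0] is empty, whereas [beta 0 = 0] surely. *)
move=> t; rewrite le_eqVlt => /predU1P[<-|t0].
  rewrite (_ : [set w | _] = set0); first exact: sigma_algebra0.
  by apply/seteqP; split => w //=; rewrite leNgt tau_gt0.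
have [mN PN] := bridge_zeros_before_end_null W_brownian tau_W_independent t0.
rewrite tauE//.
apply: (@measurableD _ (g_sigma_algebraType
  (natural_filtration beta t `|` P.-negligible))).
- apply: sub_sigma_algebra; left; apply: sub_sigma_algebra; exists t.
    by rewrite /= in_itv/= lexx ltW.
  by exists [set 0] => //; rewrite setTI.
- by apply: sub_sigma_algebra; right; exists (N t); split.
Qed.
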